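(* For every integer $d \ge 1$, $\mathrm{TTT}(4,2,d) + 1 \le \mathrm{Gr}(d+1)$.
   Context: For a finite alphabet $A$ with $|A|\ge 2$ and a group $G$ acting on $A$, a $k$-parameter subset of $A^n$ is the image of an injective map $f : A^k \to A^n$ such that for each coordinate $1 \le i \le n$, either $f_i(x_1,\dots,x_k) = a$ for some constant $a \in A$, or $f_i(x_1,\dots,x_k) = \sigma(x_j)$ for some $1\le j\le k$ and some $\sigma \in G$ (injectivity means every variable $x_j$ appears in some coordinate). Tic-tac-toe numbers: take $A = [t] = \{1,\dots,t\}$ and $G = \{e,\pi\}$ with $e(x)=x$, $\pi(x) = t+1-x$. A $d$-parameter subset of $[t]^n$ for this $G$ is called a $d$-dimensional tic-tac-toe space. $\mathrm{TTT}(t,k,d)$ is the least $n$ such that every $k$-coloring of the points of $[t]^n$ contains a monochromatic $d$-dimensional tic-tac-toe space. Graham numbers: take $A = \{\pm 1\}$ and $G = \{x\mapsto x, x \mapsto -x\}$. A $d$-parameter subset of $\{\pm1\}^n$ for this $G$ is called a $d$-dimensional subcube. An edge-coloring of $\{\pm1\}^n$ is a $2$-coloring of all edges of the complete graph on the $2^n$ points of $\{\pm1\}^n$. $\mathrm{Gr}(d)$ is the least $n$ such that every edge-coloring of $\{\pm1\}^n$ contains a $d$-dimensional subcube all of whose pairs of points (edges of the complete graph on its $2^d$ points) have the same color. *)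

(* Defs.v *)
From HB Require Import structures.
From mathcomp Require Import all_boot all_fingroup.

Set Implicit Arguments.
Unset Strict Implicit.
Unset Printing Implicit Defensive.

Notation point A n := {ffun 'I_n -> A}.

(* The alphabet A is finite, so a group acting on A enters only through its
   image in the symmetric group; G is taken to be that permutation group. *)
Definition is_param_map (A : finType) (G : {group {perm A}}) (k n : nat)
    (f : point A k -> point A n) : Prop :=
  injective f /\
  forall i : 'I_n,
    (exists a : A, forall x, f x i = a) \/
    (exists j : 'I_k, exists2 s : {perm A}, s \in G & forall x, f x i = s (x j)).

Definition is_param_subset (A : finType) (G : {group {perm A}}) (k n : nat)
    (S : {set point A n}) : Prop :=
  exists2 f : point A k -> point A n,
    is_param_map G f & S = [set f x | x : point A k].

Lemma involution_group_set (A : finType) (f : A -> A) (fK : involutive f) :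
  group_set [set 1%g; perm (inv_inj fK)].
Proof.
have ss : (perm (inv_inj fK) * perm (inv_inj fK) = 1)%g.
  by apply/permP=> x; rewrite permM !permE fK.
apply/group_setP; split=> [|x y]; first by rewrite set21.
by rewrite !inE => /orP[] /eqP-> /orP[] /eqP->;
  rewrite ?mul1g ?mulg1 ?ss eqxx ?orbT.
Qed.

Definition involution_group (A : finType) (f : A -> A) (fK : involutive f) :
  {group {perm A}} := Group (involution_group_set fK).

Definition is_least (P : nat -> Prop) (n : nat) : Prop :=
  P n /\ forall m, P m -> n <= m.

(* [t] is 'I_t, shifted to start at 0; x |-> t + 1 - x becomes rev_ord. *)
Definition is_ttt_space (t d n : nat) (S : {set point 'I_t n}) : Prop :=
  is_param_subset (involution_group (@rev_ordK t)) d S.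

Definition ttt_ramsey (t k d n : nat) : Prop :=
  forall c : point 'I_t n -> 'I_k,
  exists2 S : {set point 'I_t n}, is_ttt_space d S &
    exists a : 'I_k, forall x, x \in S -> c x = a.

(* is_TTT t k d N reads TTT(t,k,d) = N *)
Definition is_TTT (t k d N : nat) : Prop := is_least (ttt_ramsey t k d) N.

(* {-1, +1} is encoded by bool, with negb as the sign change. *)
Definition is_subcube (d n : nat) (S : {set point bool n}) : Prop :=
  is_param_subset (involution_group negbK) d S.

Definition edge (V : finType) := {e : {set V} | #|e| == 2}.

Definition graham_ramsey (d n : nat) : Prop :=
  forall c : edge (point bool n) -> 'I_2,
  exists2 S : {set point bool n}, is_subcube d S &
    exists a : 'I_2, forall e : edge (point bool n), val e \subset S -> c e = a.

(* is_Gr d M reads Gr(d) = M *)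
Definition is_Gr (d M : nat) : Prop := is_least (graham_ramsey d) M.

(* Main.v *)
Require Import Defs.
From mathcomp Require Import all_boot all_fingroup.
From Stdlib Require Import Classical.

(** A symbol of [4] is read as an ordered pair of signs; negating both signs
    is then the reversal of [4].  Order an edge of the cube {-1,+1}^(n+1) by the
    sign at the first coordinate where its endpoints differ, and delete that
    coordinate: this turns edges into words of [4]^n, so a coloring of [4]^n
    induces an edge-coloring of the cube.  In a monochromatic (d+1)-dimensional
    subcube let p be the first non-constant coordinate, governed by a
    parameter j0.  The edges whose endpoints have opposite values of j0 all
    first differ at p, and letting the d other parameters vary independently at
    the two endpoints sweeps out a d-dimensional tic-tac-toe space. *)

(** Strong induction; excluded middle decides whether a smaller witness exists, since [P] need not
    be decidable. *)
Lemma is_least_exists (P : nat -> Prop) (n : nat) :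
  P n -> exists2 N : nat, is_least P N & N <= n.
Proof.
elim/ltn_ind: n => n IHn Pn.
have [[m [ltmn Pm]]|Nm] := classic (exists m, m < n /\ P m).
  by have [N leastN leNm] := IHn m ltmn Pm; exists N => //; apply: leq_trans (ltnW ltmn).
exists n => //; split=> // m Pm; rewrite leqNgt; apply/negP => ltmn.
by apply: Nm; exists m.
Qed.

(** Binary digits: complementing both sends the value m to 3 - m, which is [rev_ord]. *)
Definition enc (a b : bool) : 'I_4 := inord (a.*2 + b).
Definition dec1 (a : 'I_4) : bool := 2 <= a.
Definition dec2 (a : 'I_4) : bool := odd a.

Lemma enc_dec (a : 'I_4) : enc (dec1 a) (dec2 a) = a.
Proof. by apply: val_inj; case: a => [[|[|[|[|]]]] //= ?]; rewrite inordK. Qed.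

Lemma dec1_enc (a b : bool) : dec1 (enc a b) = a.
Proof. by rewrite /dec1 inordK; case: a b => [] []. Qed.

Lemma dec2_enc (a b : bool) : dec2 (enc a b) = b.
Proof. by rewrite /dec2 inordK; case: a b => [] []. Qed.

Lemma enc_negb (a b : bool) : enc (~~ a) (~~ b) = rev_ord (enc a b).
Proof. by apply: val_inj; rewrite /= !inordK; case: a b => [] []. Qed.

Section FirstDifference.
Variable n : nat.
Implicit Types (x y : point bool n.+1) (p : 'I_n.+1).

Definition first_diff x y p : bool :=
  [&& ~~ x p, y p & [forall (i : 'I_n.+1 | i < p), x i == y i]].

Lemma first_diff_neq x y p : first_diff x y p -> x != y.
Proof.
by case/and3P=> Nxp yp _; apply: contraNneq Nxp => ->.
Qed.

(** Both [p] and [p'] are the first place where the same two points differ, so they agree; the sign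
    there fixes the orientation. *)
Lemma first_diff_uniq x y p x' y' p' :
  first_diff x y p -> first_diff x' y' p' ->
  x' \in [set x; y] -> y' \in [set x; y] -> (x', y', p') = (x, y, p).
Proof.
move=> xyp xyp'; have neq' := first_diff_neq _ _ _ xyp'.
case/and3P: xyp => Nxp yp /forall_inP eqp.
case/and3P: xyp' => Nxp' yp' /forall_inP eqp'.
rewrite !inE => /orP[] /eqP ex /orP[] /eqP ey; subst x' y'; rewrite ?eqxx // in neq'.
- case: (ltngtP p' p) => [lt|lt|/val_inj-> //].
    by move: (eqp _ lt) Nxp' yp' => /eqP -> /negbTE ->.
  by move: (eqp' _ lt) Nxp yp => /eqP -> /negbTE ->.
- case: (ltngtP p' p) => [lt|lt|/val_inj ep].
  + by move: (eqp _ lt) Nxp' yp' => /eqP -> /negbTE ->.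
  + by move: (eqp' _ lt) Nxp yp => /eqP -> /negbTE ->.
  by move: Nxp'; rewrite ep yp.
Qed.

Definition pair_word x y p : point 'I_4 n :=
  [ffun i => enc (x (lift p i)) (y (lift p i))].

Lemma pair_word_inj x y x' y' p :
  x p = x' p -> y p = y' p -> pair_word x y p = pair_word x' y' p ->
  x = x' /\ y = y'.
Proof.
move=> exp eyp /ffunP ew.
have ei i : x i = x' i /\ y i = y' i.
  case: (unliftP p i) => [k|] -> //; have := ew k; rewrite !ffunE => ek.
  by split; [have := congr1 dec1 ek | have := congr1 dec2 ek];
    rewrite ?dec1_enc ?dec2_enc.
by split; apply/ffunP => i; have [] := ei i.
Qed.

(* The [None] branch never occurs: every edge has a first difference. *)
Definition edge_coloring (c : point 'I_4 n -> 'I_2) (e : edge (point bool n.+1)) :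
    'I_2 :=
  if [pick t : point bool n.+1 * point bool n.+1 * 'I_n.+1 |
       [&& t.1.1 \in val e, t.1.2 \in val e & first_diff t.1.1 t.1.2 t.2]]
  is Some t then c (pair_word t.1.1 t.1.2 t.2) else ord0.

Lemma edge_coloringE c (e : edge (point bool n.+1)) x y p :
  first_diff x y p -> val e = [set x; y] ->
  edge_coloring c e = c (pair_word x y p).
Proof.
move=> xyp ve; rewrite /edge_coloring; case: pickP => [[[x' y'] p'] /=|].
  rewrite ve => /and3P[x'e y'e xyp'].
  by have [-> -> ->] := first_diff_uniq _ _ _ _ _ _ xyp xyp' x'e y'e.
by move/(_ (x, y, p)); rewrite /= ve set21 set22 xyp.
Qed.

End FirstDifference.

Lemma in_involution_group (A : finType) (f : A -> A) (fK : involutive f)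
    (s : {perm A}) :
  s \in involution_group fK -> s =1 id \/ s =1 f.
Proof.
rewrite !inE => /orP[] /eqP->; [left | right] => x; first by rewrite perm1.
by rewrite permE.
Qed.

Lemma involution_group1 (A : finType) (f : A -> A) (fK : involutive f) :
  1%g \in involution_group fK.
Proof. by rewrite !inE eqxx. Qed.

Lemma involution_groupf (A : finType) (f : A -> A) (fK : involutive f) :
  perm (inv_inj fK) \in involution_group fK.
Proof. by rewrite !inE eqxx orbT. Qed.

Definition extend {A : finType} {d : nat} (j0 : 'I_d.+1) (b : A)
    (x : point A d) : point A d.+1 :=
  [ffun j => if unlift j0 j is Some k then x k else b].

Lemma extend_at {A : finType} {d : nat} (j0 : 'I_d.+1) (b : A) (x : point A d) :
  extend j0 b x j0 = b.
Proof. by rewrite ffunE unlift_none. Qed.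

Lemma extend_lift {A : finType} {d : nat} (j0 : 'I_d.+1) (b : A)
    (x : point A d) (k : 'I_d) :
  extend j0 b x (lift j0 k) = x k.
Proof. by rewrite ffunE liftK. Qed.

Lemma extend_inj {A : finType} {d : nat} (j0 : 'I_d.+1) (b : A) :
  injective (extend j0 b).
Proof.
by move=> x y exy; apply/ffunP=> k; rewrite -(extend_lift j0 b) exy extend_lift.
Qed.

(** By injectivity the all-false and all-true points have distinct images, so some coordinate is not
    constant; [p] is the least such. *)
Lemma param_map_first_coordinate (d n : nat)
    (G : {group {perm bool}}) (f : point bool d.+1 -> point bool n) :
  is_param_map G f ->
  exists p : 'I_n, exists j0 : 'I_d.+1, exists2 s : {perm bool}, s \in G &
    (forall x, f x p = s (x j0)) /\
    forall i : 'I_n, i < p -> forall x y, f x i = f y i.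
Proof.
case=> injf fP.
pose nonconst (i : 'I_n) := [exists x, exists y, f x i != f y i].
have [i0 nc0] : exists i, nonconst i.
  apply/existsP; apply: contraT; rewrite negb_exists => /forallP cst.
  have : f [ffun=> false] = f [ffun=> true].
    apply/ffunP => i; apply/eqP; apply: contraNT (cst i) => neq.
    by apply/existsP; exists [ffun=> false]; apply/existsP; exists [ffun=> true].
  by move/injf/ffunP/(_ ord0); rewrite !ffunE.
case: (arg_minnP (fun i : 'I_n => i : nat) nc0) => p ncp minp.
exists p; case: (fP p) => [[a fa]|[j0 [s sG fs]]].
  by case/existsP: ncp => x /existsP[y]; rewrite !fa eqxx.
exists j0, s => //; split=> // i ltip x y; apply/eqP.
apply: contraTT ltip => neq; rewrite -leqNgt; apply: minp.
by apply/existsP; exists x; apply/existsP; exists y.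
Qed.

Lemma graham_ramsey_ttt (d n : nat) :
  graham_ramsey d.+1 n.+1 -> ttt_ramsey 4 2 d n.
Proof.
move=> gr c; have [S [f fpar ->] [a mono]] := gr (edge_coloring n c).
have [p [j0 [s sG [fp fconst]]]] := param_map_first_coordinate _ _ _ _ fpar.
case: fpar => injf fP.
(* Freezing parameter [j0] at the preimages under [s] of [false] and [true] orients every edge from
   [u y] to [v y] at [p]. *)
pose u (y : point 'I_4 d) := f (extend j0 (s^-1%g false) [ffun k => dec1 (y k)]).
pose v (y : point 'I_4 d) := f (extend j0 (s^-1%g true) [ffun k => dec2 (y k)]).
have up y : u y p = false by rewrite /u fp extend_at permKV.
have vp y : v y p = true by rewrite /v fp extend_at permKV.
have uvp y : first_diff n (u y) (v y) p.
  rewrite /first_diff up vp; apply/forall_inP => i ltip.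
  by apply/eqP; apply: fconst.
pose g y := pair_word n (u y) (v y) p.
exists [set g y | y : point 'I_4 d].
  exists g => //; split=> [y y'|i].
    case/pair_word_inj; rewrite ?up ?vp // => /injf/extend_inj/ffunP e1.
    move=> /injf/extend_inj/ffunP e2; apply/ffunP => k.
    by move: (e1 k) (e2 k); rewrite !ffunE => e1k e2k;
      rewrite -[y k]enc_dec -[y' k]enc_dec e1k e2k.
  case: (fP (lift p i)) => [[b fb]|[j [r rG fr]]].
    by left; exists (enc b b) => y; rewrite ffunE /u /v !fb.
  (* A coordinate governed by [j0] is frozen at both endpoints, so its symbol is constant; one
     governed by another parameter carries [y k] or its reversal. *)
  case: (unliftP j0 j) => [k|] ej; subst j; last first.
    by left; eexists => y; rewrite ffunE /u /v !fr !extend_at.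
  right; exists k; case: (in_involution_group _ _ _ _ rG) => rE.
    exists 1%g; first exact: involution_group1.
    by move=> y; rewrite ffunE /u /v !fr !extend_lift !rE !ffunE enc_dec perm1.
  exists (perm (inv_inj (@rev_ordK 4))); first exact: involution_groupf.
  by move=> y; rewrite ffunE /u /v !fr !extend_lift !rE !ffunE enc_negb enc_dec permE.
exists a => _ /imsetP[y _ ->].
have card2 : #|[set u y; v y]| == 2.
  by rewrite cards2 (first_diff_neq _ _ _ _ (uvp y)).
pose e : edge (point bool n.+1) :=
  exist (fun e : {set point bool n.+1} => #|e| == 2) _ card2.
rewrite -(edge_coloringE n c e _ _ _ (uvp y)) //; apply: mono.
by apply/subsetP => x /set2P[] ->; apply: imset_f.
Qed.

(** A subcube of positive dimension needs a non-constant coordinate; this provides the coordinate to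
    delete. *)
Lemma graham_ramsey_gt0 (d n : nat) : graham_ramsey d.+1 n -> 0 < n.
Proof.
move=> gr; have [S [f fpar _] _] := gr (fun=> ord0).
by have [p _] := param_map_first_coordinate _ _ _ _ fpar; case: n p {gr S f fpar} => [[]|].
Qed.

(* With the least element of an empty set read as infinity, this is
   TTT(4,2,d) + 1 <= Gr(d+1) in the extended naturals; in particular
   it includes that TTT(4,2,d) exists as soon as Gr(d+1) does. *)
Theorem theorem1p2 (d : nat) (hd : 1 <= d) (M : nat) (hM : is_Gr (d + 1) M) :
  exists2 N : nat, is_TTT 4 2 d N & N + 1 <= M.
Proof.
case: hM; rewrite addn1 => gr _; have := graham_ramsey_gt0 _ _ gr.
case: M gr => // n /graham_ramsey_ttt/is_least_exists[N leastN leNn] _.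
by exists N; rewrite // addn1.
Qed.
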